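(* Let $\alpha,\beta$ be positive irrational numbers and let $\Delta_\alpha=\{p\alpha+q:p,q\in\mathbb{Q}\}\cap(0,+\infty)$, $\Delta_\beta=\{p\beta+q:p,q\in\mathbb{Q}\}\cap(0,+\infty)$. Then $\Delta_\alpha$ and $\Delta_\beta$ are equivalent if and only if there is a matrix $\begin{pmatrix}a&b\\c&d\end{pmatrix}\in GL_2(\mathbb{Q})$ with $\beta=\frac{a\alpha+b}{c\alpha+d}$ (i.e. $\alpha$ and $\beta$ are $E^{IR}_{GL_2(\mathbb{Q})}$-equivalent).
   Context: A triple $(x,y,z)$ of positive reals is a $\Delta$-triangle if $x,y,z\in\Delta$ and $|x-y|\le z\le x+y$. Sets $\Delta,\Lambda$ of positive reals (distance value sets) are equivalent if there is a bijection $f:\Delta\to\Lambda$ such that for all positive reals $x,y,z$, $(x,y,z)$ is a $\Delta$-triangle iff $(f(x),f(y),f(z))$ is a $\Lambda$-triangle. $E^{IR}_{GL_2(\mathbb{Q})}$ is the orbit equivalence relation of the action of $GL_2(\mathbb{Q})$ on the irrational numbers by linear fractional transformations. *)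

(* Defs.v *)
From HB Require Import structures.
From mathcomp Require Import all_boot all_order all_algebra.
From mathcomp Require Import all_classical all_reals.

Set Implicit Arguments.
Unset Strict Implicit.
Unset Printing Implicit Defensive.

Import Order.TTheory GRing.Theory Num.Theory.
Local Open Scope classical_set_scope.
Local Open Scope ring_scope.

Definition is_triangle (R : realType) (D : set R) (x y z : R) : Prop :=
  [/\ 0 < x, 0 < y & 0 < z] /\
  [/\ D x, D y & D z] /\ `|x - y| <= z <= x + y.

(* A bijection from D to L is a total map R -> R that is bijective from D to L.
   Its values outside D carry no meaning, so x, y, z range over D, the domain
   of the bijection. *)
Definition dvs_equivalent (R : realType) (D L : set R) : Prop :=
  exists f : R -> R, set_bij D L f /\
    forall x y z : R, D x -> D y -> D z ->
      (is_triangle D x y z <-> is_triangle L (f x) (f y) (f z)).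

Definition Delta (R : realType) (a : R) : set R :=
  [set x | exists p q : rat, x = ratr p * a + ratr q] `&` [set x | 0 < x].

(* For irrational x and invertible M the denominator is nonzero. *)
Definition lin_frac (R : realType) (M : 'M[rat]_2) (x : R) : R :=
  (ratr (M 0 0) * x + ratr (M 0 1)) / (ratr (M 1 0) * x + ratr (M 1 1)).

Definition GL2Q_equivalent (R : realType) (x y : R) : Prop :=
  exists M : 'M[rat]_2, M \in unitmx /\ y = lin_frac M x.

(* Main.v *)
Require Import Defs.
From mathcomp Require Import all_boot all_order all_algebra.
From mathcomp Require Import all_classical all_reals.
From mathcomp Require Import ring lra.

Set Implicit Arguments.
Unset Strict Implicit.
Unset Printing Implicit Defensive.

Import Order.TTheory GRing.Theory Num.Theory.
Local Open Scope ring_scope.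

(** In an additive semigroup of positive reals the triangle relation determines
    the order, since [(x, x, z)] is a triangle iff [z <= 2 x], and the addition,
    since [x + y] is the largest [z] such that [(x, y, z)] is a triangle.  Hence
    an equivalence of such semigroups is additive and increasing, and therefore
    a multiplication by a positive constant [c].  Applied to [Delta alpha] and
    [Delta beta] this says that [c] and [c * alpha] both lie in the [rat]-span
    of [beta] and [1], so that their quotient [alpha] is a linear fractional
    image of [beta].  Conversely, if [beta = (a alpha + b) / (c alpha + d)],
    then division by [`|c alpha + d|] is an equivalence. *)

Definition pos_semigroup (R : realType) (D : set R) : Prop :=
  (forall x, D x -> 0 < x) /\ (forall x y, D x -> D y -> D (x + y)).

(** This is [dvs_equivalent] with its witness [f] exposed, so that statements can be made about a
    fixed map. *)
Definition is_dvs_equivalence (R : realType) (D L : set R) (f : R -> R) : Prop :=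
  set_bij D L f /\
  forall x y z : R, D x -> D y -> D z ->
    (is_triangle D x y z <-> is_triangle L (f x) (f y) (f z)).

Lemma is_triangleP (R : realType) (D : set R) (x y z : R) :
  pos_semigroup D -> D x -> D y -> D z ->
  is_triangle D x y z <-> `|x - y| <= z <= x + y.
Proof.
move=> [D0 _] Dx Dy Dz; split=> [[_ []]//|xyz].
by split; [split; exact: D0|split].
Qed.

Section dvs_equivalence.
Context {R : realType} {D L : set R} {f : R -> R}.
Context (sD : pos_semigroup D) (sL : pos_semigroup L).
Context (eqf : is_dvs_equivalence D L f).

Let f_in x : D x -> L (f x).
Proof. by case: eqf => -[ff _ _] _; exact: ff. Qed.

Let f_onto y : L y -> exists2 x, D x & f x = y.
Proof. by case: eqf => -[_ _ fs] _ /fs. Qed.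

Let f_triangle x y z : D x -> D y -> D z ->
  (`|x - y| <= z <= x + y) = (`|f x - f y| <= f z <= f x + f y).
Proof.
move=> Dx Dy Dz; apply/idP/idP.
- move=> /(is_triangleP sD Dx Dy Dz) /(eqf.2 _ _ _ Dx Dy Dz).
  by move=> /(is_triangleP sL (f_in Dx) (f_in Dy) (f_in Dz)).
- move=> /(is_triangleP sL (f_in Dx) (f_in Dy) (f_in Dz)).
  by move=> /(eqf.2 _ _ _ Dx Dy Dz) /(is_triangleP sD Dx Dy Dz).
Qed.

Let f_le_double x z : D x -> D z -> (z <= x + x) = (f z <= f x + f x).
Proof.
move=> Dx Dz; have := f_triangle Dx Dx Dz.
by rewrite !subrr normr0 (ltW (sD.1 _ Dz)) (ltW (sL.1 _ (f_in Dz))).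
Qed.

(** A preimage [z] of [f x + f x] satisfies [z <= x + x <= y + y], and doubling [y] then bounds
    [f z] by [f y + f y]. *)
Lemma dvs_equivalence_le x y : D x -> D y -> x <= y -> f x <= f y.
Proof.
move=> Dx Dy xy; have [z Dz fz] := f_onto (sL.2 _ _ (f_in Dx) (f_in Dx)).
have := f_le_double Dx Dz; rewrite fz lexx => zx.
have := f_le_double Dy Dz; rewrite fz; lra.
Qed.

Lemma dvs_equivalenceD x y : D x -> D y -> f (x + y) = f x + f y.
Proof.
move=> Dx Dy; have [x0 y0] := (sD.1 _ Dx, sD.1 _ Dy).
have Dxy := sD.2 _ _ Dx Dy; apply/eqP; rewrite eq_le; apply/andP; split.
  have := f_triangle Dx Dy Dxy; rewrite lexx andbT => /esym.
  have -> : `|x - y| <= x + y by rewrite ler_norml; lra.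
  by case/andP.
have [fx0 fy0] := (sL.1 _ (f_in Dx), sL.1 _ (f_in Dy)).
(* For the reverse inequality, the preimage [w] of [f x + f y] is at most [x + y], and [f] is
   monotone. *)
have [w Dw fw] := f_onto (sL.2 _ _ (f_in Dx) (f_in Dy)).
have := f_triangle Dx Dy Dw; rewrite fw lexx andbT.
have -> : `|f x - f y| <= f x + f y by rewrite ler_norml; lra.
by case/andP=> _ wxy; rewrite -fw; exact: dvs_equivalence_le.
Qed.

Lemma pos_semigroupMn x n : D x -> D (x *+ n.+1).
Proof.
by move=> Dx; elim: n => // n IHn; rewrite mulrS; exact: sD.2.
Qed.

Lemma dvs_equivalenceMn x n : D x -> f (x *+ n.+1) = f x *+ n.+1.
Proof.
move=> Dx; elim: n => // n IHn.
by rewrite mulrS dvs_equivalenceD ?IHn -?mulrS//; exact: pos_semigroupMn.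
Qed.

(** Archimedean comparison: for [m] the integer part of [n * x / y], additivity and monotonicity
    turn [m * y <= n * x] into [m * f y <= n * f x]. A positive gap [f y * x - f x * y] then
    contradicts this for large [n]. *)
Let f_slope_le x y : D x -> D y -> f y * x <= f x * y.
Proof.
move=> Dx Dy; rewrite leNgt; apply/negP => lt_xy.
have [x0 y0] := (sD.1 _ Dx, sD.1 _ Dy).
have [fx0 fy0] := (sL.1 _ (f_in Dx), sL.1 _ (f_in Dy)).
have gap0 : 0 < f y * x - f x * y by rewrite subr_gt0.
have /archi_boundP : 0 <= f y * y / (f y * x - f x * y).
  by rewrite divr_ge0 ?ltW// mulr_gt0.
move: (Num.Def.archi_bound _) => n; rewrite ltr_pdivrMr// => n_gap.
have /truncn_itv : 0 <= n%:R * x / y.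
  by rewrite divr_ge0 ?mulr_ge0 ?ler0n ?ltW.
move: (Num.Def.trunc _) => m /andP[]; rewrite ler_pdivlMr// ltr_pdivrMr// => m_le.
rewrite -natr1 => m_lt.
have m_f : m%:R * f y <= n%:R * f x.
  (* Zero multiples are treated apart, since [D] does not contain [0]. *)
  case: m n m_le {m_lt n_gap} => [|m] [|n] m_le.
  - by rewrite !mul0r.
  - by rewrite mul0r mulr_ge0 ?ler0n ?ltW.
  - by move: m_le; rewrite mul0r pmulr_lle0// lern0.
  - move: m_le; rewrite !mulr_natl -!dvs_equivalenceMn//.
    by apply: dvs_equivalence_le; exact: pos_semigroupMn.
have : m%:R * f y * y <= n%:R * f x * y by rewrite ler_pM2r.
have : n%:R * x * f y < (m%:R + 1) * y * f y by rewrite ltr_pM2r.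
lra.
Qed.

Lemma dvs_equivalence_linear x y : D x -> D y -> f y * x = f x * y.
Proof. by move=> Dx Dy; apply/eqP; rewrite eq_le !f_slope_le. Qed.

End dvs_equivalence.

(** The triangle inequalities are homogeneous. *)
Lemma dvs_equivalent_scale (R : realType) (D L : set R) (k : R) : 0 < k ->
  (forall x, D x <-> L (k * x)) -> dvs_equivalent D L.
Proof.
move=> k0 DL; have kn0 : k != 0 by rewrite gt_eqF.
exists ( *%R k); split.
  split=> [x Dx|x y _ _ /(mulfI kn0)//|y Ly]; first exact/DL.
  by exists (k^-1 * y); [apply/DL|]; rewrite mulVKf.
move=> x y z Dx Dy Dz; rewrite /is_triangle -mulrBr -mulrDr normrM (gtr0_norm k0).
rewrite !(pmulr_rgt0 _ k0) !(ler_pM2l k0).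
by split=> -[pos [_ xyz]]; split=> //; split=> //; split=> //; apply/DL.
Qed.

Lemma Delta_pos_semigroup (R : realType) (a : R) : pos_semigroup (Delta a).
Proof.
split=> [x []//|x y [[p [q ->]] x0] [[p' [q' ->]] y0]].
split; last exact: addr_gt0.
by exists (p + p'), (q + q'); rewrite !rmorphD/=; ring.
Qed.

(** Linear independence of [x] and [1] over [rat]: a vanishing combination with [p != 0] would give
    [x = - q / p]. *)
Lemma irrational_lin_neq0 (R : realType) (x : R) (p q : rat) : irrational x ->
  (p != 0) || (q != 0) -> ratr p * x + ratr q != 0.
Proof.
move=> xirr pq; apply/eqP => e; have [p0|pn0] := eqVneq p 0.
  move: e pq; rewrite p0 eqxx rmorph0 mul0r add0r => /eqP.
  by rewrite fmorph_eq0 => ->.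
apply: xirr; exists (- q / p) => //.
have rp0 : ratr p != 0 :> R by rewrite fmorph_eq0.
rewrite fmorph_div rmorphN/=; apply: (mulfI rp0).
by rewrite mulrCA divff// mulr1; lra.
Qed.

Lemma det_mx2 (A : comNzRingType) (M : 'M[A]_2) :
  \det M = M 0 0 * M 1 1 - M 0 1 * M 1 0.
Proof.
rewrite (expand_det_row _ 0) !big_ord_recl big_ord0 /cofactor !det_mx11 !mxE/=.
rewrite !expr0 expr1 mul1r addr0 mulN1r mulrN.
by congr (M _ _ * M _ _ - M _ _ * M _ _); apply/val_inj.
Qed.

Lemma GL2Q_equivalent_Delta (R : realType) (alpha beta : R) :
  irrational alpha -> GL2Q_equivalent alpha beta ->
  dvs_equivalent (Delta alpha) (Delta beta).
Proof.
move=> airr [M [Mu ->]]; move: Mu; rewrite unitmxE unitfE det_mx2 /lin_frac.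
move: (M 0 0) (M 0 1) (M 1 0) (M 1 1) => a b c d det0.
have e0 : ratr c * alpha + ratr d != 0.
  apply: irrational_lin_neq0 => //; rewrite -negb_and; apply: contra det0.
  by move=> /andP[/eqP-> /eqP->]; rewrite !mulr0 subr0.
set e := ratr c * alpha + ratr d in e0 *.
have det0R : ratr a * ratr d - ratr b * ratr c != 0 :> R.
  by rewrite -!rmorphM -rmorphB fmorph_eq0.
(* The sign of [e] is taken in [rat], so that it can be absorbed into the rational coefficients. *)
have [s s1 se] : exists2 s : rat, s * s = 1 & `|e| = ratr s * e.
  have [e_ge0|e_lt0] := leP 0 e.
    by exists 1; rewrite ?mulr1// rmorph1 mul1r ger0_norm.
  by exists (-1); rewrite ?mulrNN ?mulr1// rmorphN1 mulN1r ltr0_norm.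
have sR : ratr s * ratr s = 1 :> R by rewrite -rmorphM s1 rmorph1.
have s0R : ratr s != 0 :> R.
  by apply: contra_eq_neq sR => ->; rewrite mul0r eq_sym oner_neq0.
apply: (@dvs_equivalent_scale _ _ _ `|e|^-1); first by rewrite invr_gt0 normr_gt0.
move=> x; rewrite /Delta/=.
have -> : (0 < `|e|^-1 * x) = (0 < x) by rewrite pmulr_rgt0// invr_gt0 normr_gt0.
split=> -[[p [q xpq]] x0]; split=> //; last first.
  exists (s * (p * a + q * c)), (s * (p * b + q * d)).
  have -> : x = `|e| * (`|e|^-1 * x) by rewrite mulVKf ?normr_eq0.
  by rewrite xpq se !(rmorphM, rmorphD)/= /e; field.
(* Cramer's rule for the coefficients found in the other direction, with [s] its own inverse. *)
pose det := a * d - b * c.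
exists (s * (p * d - q * c) / det), (s * (q * a - p * b) / det).
have -> : `|e|^-1 = ratr s / e.
  apply: (mulIf e0); rewrite mulfVK// se invfM mulfVK//.
  by apply: (mulfI s0R); rewrite divff.
rewrite xpq !(rmorphM, rmorphB, fmorphV)/= /e; field.
by rewrite e0 det0R.
Qed.

Lemma dvs_equivalent_GL2Q (R : realType) (alpha beta : R) :
  0 < alpha -> irrational alpha ->
  dvs_equivalent (Delta alpha) (Delta beta) -> GL2Q_equivalent alpha beta.
Proof.
move=> a0 airr [f eqf].
have D1 : Delta alpha 1.
  split=> //=; exists 0, 1; by rewrite rmorph0 rmorph1 mul0r add0r.
have Da : Delta alpha alpha.
  split=> //=; exists 1, 0; by rewrite rmorph0 rmorph1 mul1r addr0.
have ff : forall x, Delta alpha x -> Delta beta (f x).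
  by case: eqf => -[ff _ _] _; exact: ff.
have := dvs_equivalence_linear (Delta_pos_semigroup alpha)
  (Delta_pos_semigroup beta) eqf D1 Da.
rewrite mulr1; have [[p [q ->]] c0] := ff _ D1; have [[p' [q' ->]] _] := ff _ Da.
move=> lin.
(* Here [lin] reads [p' beta + q' = (p beta + q) alpha]. If the determinant vanished, then
   [(p beta + q) (p alpha - p') = 0] with a positive first factor, so [p = p' = 0] and
   [q alpha = q'] with [q > 0], against irrationality. *)
have det0 : q * p' - q' * p != 0.
  apply/eqP => det0; have det0R : ratr q * ratr p' = ratr q' * ratr p :> R.
    by rewrite -!rmorphM; congr ratr; lra.
  have : (ratr p * beta + ratr q) * (ratr p * alpha + ratr (- p')) = 0.
    rewrite rmorphN/= mulrDr mulrCA mulrA -mulrA -lin; lra.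
  move/eqP; rewrite mulf_eq0 (gt_eqF c0)/= => /eqP den0.
  have /norP[] : ~~ ((p != 0) || (- p' != 0)).
    by apply: contra_eqN den0; exact: irrational_lin_neq0.
  rewrite !negbK oppr_eq0 => /eqP p0 /eqP p'0.
  move: c0 lin; rewrite p0 p'0 rmorph0 !mul0r !add0r /= => q0 /esym/eqP.
  rewrite -subr_eq0 -rmorphN; apply/negP/irrational_lin_neq0 => //.
  by move: q0; rewrite lt_neqAle eq_sym fmorph_eq0 => /andP[->].
have den0 : ratr p * alpha + ratr (- p') != 0.
  apply: irrational_lin_neq0 => //; rewrite oppr_eq0 -negb_and.
  by apply: contra det0 => /andP[/eqP-> /eqP->]; rewrite !mulr0 subrr.
(* Solving [lin] for [beta] gives [(- q alpha + q') / (p alpha - p')]. *)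
exists (\matrix_(i, j) if i == 0 then if j == 0 then - q else q'
                       else if j == 0 then p else - p').
rewrite unitmxE unitfE det_mx2 /lin_frac !mxE/= mulrNN; split=> //.
apply: (mulIf den0); rewrite mulfVK// !rmorphN/=; lra.
Qed.

Theorem theorem4p8 (R : realType) (alpha beta : R)
    (alpha_gt0 : 0 < alpha) (alpha_irr : irrational alpha)
    (beta_gt0 : 0 < beta) (beta_irr : irrational beta) :
  dvs_equivalent (Delta alpha) (Delta beta) <-> GL2Q_equivalent alpha beta.
Proof.
split; first exact: dvs_equivalent_GL2Q.
exact: GL2Q_equivalent_Delta.
Qed.
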